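(* Let $X$ be a Tychonoff space and let $Y$ be an infinite subset of $X$. Then $L(Y,X)$, the linear subspace of the free locally convex space $L(X)$ generated by the elements of $Y$ (with the topology induced from $L(X)$), is not a Gâteaux Differentiability Space. In particular, $L(X)$ is not a Gâteaux Differentiability Space for any infinite Tychonoff space $X$.
   Context: All vector spaces are real; all topological vector spaces are Hausdorff; ''lcs'' means locally convex space. A lcs $E$ is a Gâteaux Differentiability Space (GDS) if every continuous convex function $f:D\to\mathbb{R}$, where $D\subset E$ is a nonempty open convex set, is Gâteaux differentiable on a dense subset of $D$. Here $f$ is Gâteaux differentiable at $x\in D$ if there is a continuous linear functional $x^*\in E'$ with $\lim_{t\to 0}\frac{f(x+ty)-f(x)}{t}=x^*(y)$ for every $y\in E$. For a Tychonoff space $X$, the free lcs $L(X)$ is a lcs together with a continuous map $i:X\to L(X)$ such that every continuous map $f$ from $X$ to a lcs $E$ gives rise to a unique continuous linear operator $\widehat f:L(X)\to E$ with $f=\widehat f\circ i$. It always exists and is unique; $i$ is a topological embedding, $i(X)$ is a Hamel basis of $L(X)$, and $X$ is identified with $i(X)$. *)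

(* Defs.v *)
From HB Require Import structures.
From mathcomp Require Import all_boot all_order all_algebra.
From mathcomp Require Import interval_inference.
From mathcomp Require Import all_classical all_reals all_analysis.

Set Implicit Arguments.
Unset Strict Implicit.
Unset Printing Implicit Defensive.

Import Order.TTheory GRing.Theory Num.Theory.
Import numFieldNormedType.Exports.

Local Open Scope classical_set_scope.
Local Open Scope ring_scope.

Definition tychonoff_space (X : topologicalType) : Prop :=
  completely_regular_space X /\ hausdorff_space X.

(* [tvsType R] does not include the Hausdorff axiom, which is therefore
   required both of [L] and of the spaces [E] in the universal property. *)
Definition free_lcs (R : realType) (X : topologicalType) (L : tvsType R)
    (i : X -> L) : Prop :=
  [/\ hausdorff_space L,
      continuous i &
      forall (E : tvsType R) (f : X -> E),
        hausdorff_space E -> continuous f ->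
        exists! g : L -> E, [/\ linear g, continuous g & f = g \o i] ].

(* [f] is only meaningful near [x]; the limit at t = 0 is over t != 0. *)
Definition gateaux_differentiable (R : realType) (E : tvsType R)
    (f : E -> R^o) (x : E) : Prop :=
  exists df : {linear E -> R^o}, continuous df /\
    forall y : E, (f (x + t *: y) - f x) / t @[t --> (0 : R)^'] --> df y.

(* A function on [D] is a total function of which only the values on [D]
   matter: [D] is open, so Gateaux differentiability at a point of [D] only
   depends on them. *)
Definition GDS (R : realType) (E : tvsType R) : Prop :=
  forall (D : set E) (f : E -> R^o),
    D !=set0 -> open D -> convex_set D ->
    {within D, continuous f} -> convex_function D f ->
    D `<=` closure [set x | D x /\ gateaux_differentiable f x].

Section LinearSpan.
Context {R : realType} {V : lmodType R}.

Definition lspan (A : set V) : set V :=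
  [set v | exists (n : nat) (a : 'I_n -> R) (x : 'I_n -> V),
    (forall j, A (x j)) /\ v = \sum_(j < n) a j *: x j].

Lemma lspan_submod_closed (A : set V) :
  submod_closed (fun v => v \in lspan A).
Proof.
split=> [|c u v].
  by apply/mem_set; exists 0%N, (fun=> 0), (fun=> 0); split=> [[]//|];
    rewrite big_ord0.
move=> /set_mem[m [a [x [Ax ->]]]] /set_mem[n [b [y [Ay ->]]]].
apply/mem_set; exists (m + n)%N.
exists (fun j => match fintype.split j with inl k => c * a k | inr k => b k end).
exists (fun j => match fintype.split j with inl k => x k | inr k => y k end).
split=> [j|]; first by case: (fintype.split j).
rewrite big_split_ord/= scaler_sumr; congr (_ + _); apply: eq_bigr => k _.
  by rewrite (unsplitK (inl k)) scalerA.
by rewrite (unsplitK (inr k)).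
Qed.

End LinearSpan.

Definition span_of {R : realType} {V : lmodType R} (A : set V) : Type :=
  set_type (lspan A).

HB.instance Definition _ (R : realType) (V : lmodType R) (A : set V) :=
  SubChoice.on (span_of A).
HB.instance Definition _ (R : realType) (V : lmodType R) (A : set V) :=
  GRing.SubChoice_isSubLmodule.Build R V (fun v => v \in lspan A) (span_of A)
    (GRing.submod_closed_semi (lspan_submod_closed A)).

(* The library gives [set_type] the uniformity, hence the topology, induced by
   the ambient space. *)
HB.instance Definition _ (R : realType) (E : tvsType R) (A : set E) :=
  Uniform.copy (span_of A) (set_type (lspan A)).

Section SpanTvs.
Context {R : realType} {E : tvsType R} (A : set E).

Let val_continuous : continuous (val : span_of A -> E).
Proof. exact: initial_continuous. Qed.

Let continuous_to_span (T : topologicalType) (f : T -> span_of A) :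
  continuous (val \o f) -> continuous f.
Proof. exact: continuous_comp_initial. Qed.

Let span_add_continuous :
  continuous (fun x : span_of A * span_of A => x.1 + x.2).
Proof.
apply: continuous_to_span => z.
rewrite (_ : _ \o _ = fun x : span_of A * span_of A => val x.1 + val x.2)//.
apply: (@continuous_comp (span_of A * span_of A)%type (E * E)%type E (fun x => (val x.1, val x.2))
  (fun x : E * E => x.1 + x.2)); last exact: add_continuous.
apply: cvg_pair => /=.
  by apply: continuous_comp; [exact: cvg_fst|exact: val_continuous].
by apply: continuous_comp; [exact: cvg_snd|exact: val_continuous].
Qed.

Let span_scale_continuous :
  continuous (fun z : R^o * span_of A => z.1 *: z.2).
Proof.
apply: continuous_to_span => z.
rewrite (_ : _ \o _ = fun x : R^o * span_of A => x.1 *: val x.2)//.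
apply: (@continuous_comp (R^o * span_of A)%type (R^o * E)%type E (fun x => (x.1, val x.2))
  (fun x : R^o * E => x.1 *: x.2)); last exact: scale_continuous.
apply: (@cvg_pair _ _ _ _ (nbhs (z.1 : R^o)) (nbhs (val z.2 : E))) => /=; first exact: cvg_fst.
by apply: continuous_comp; [exact: cvg_snd|exact: val_continuous].
Qed.

Let span_locally_convex : exists2 B : set_system (span_of A),
  (forall b, b \in B -> convex_set b) & basis B.
Proof.
have [B Bc [Bo Bn]] := @locally_convex R E.
exists [set val @^-1` b | b in B].
  move=> _ /set_mem[b Bb <-] x y l /set_mem xb /set_mem yb; apply/mem_set.
  have /(_ (val x) (val y) l) := Bc b (mem_set Bb).
  by rewrite !inE; apply.
split=> [_ [b Bb <-]|x U].
  by exists b => //; exact: Bo.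
rewrite nbhsE/= => -[_ [[V oV <-]] Vx] VU.
have /Bn[b [Bb bx] bV] : nbhs (val x) V by exact: open_nbhs_nbhs.
exists (val @^-1` b); first by split => //; exists b.
by move=> y /bV /VU.
Qed.

HB.instance Definition _ := PreTopologicalNmodule_isTopologicalNmodule.Build
  (span_of A) span_add_continuous.
HB.instance Definition _ := TopologicalNmodule_isTopologicalLmodule.Build
  R (span_of A) span_scale_continuous.
HB.instance Definition _ :=
  Uniform_isTvs.Build R (span_of A) span_locally_convex.

End SpanTvs.

(* Main.v *)
(** Choose pairwise disjoint bumps [g_n] on [X] with [g_n y_n != 0] at points
    [y_n] of [Y] and [`|g_n| <= 1/(n+1)]. Since the bumps decay, the map
    [F x = \sum_n g_n x *: 'X^n] from [X] to the finitely supported sequences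
    with the l1 norm is continuous, so it extends to a continuous linear [T] on
    [L]. The continuous convex function [`|T v|] is nowhere Gateaux
    differentiable: at any [v], all but finitely many coordinates of [T v]
    vanish, and moving along [y_n] for a vanishing coordinate [n] adds [c `|t|],
    with [c > 0], to the norm. *)
From HB Require Import structures.
Require Import Defs.
From mathcomp Require Import all_boot all_order all_algebra.
From mathcomp Require Import lra.
From mathcomp Require Import all_classical all_reals all_analysis.

Set Implicit Arguments.
Unset Strict Implicit.
Unset Printing Implicit Defensive.

Import Order.TTheory GRing.Theory Num.Theory.
Import numFieldNormedType.Exports.

Local Open Scope classical_set_scope.
Local Open Scope ring_scope.

(* Polynomials stand for finitely supported sequences; the alias keeps the l1
   norm from being attached to [{poly R}] itself. *)
Definition l1poly (R : realType) : Type := {poly R}.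

HB.instance Definition _ (R : realType) := GRing.Lmodule.on (l1poly R).

(** * The l1 norm on finitely supported sequences *)

Section L1Norm.
Variable R : realType.
Implicit Types p q : {poly R}.

Definition l1norm p : R := \sum_(i < size p) `|p`_i|.

Lemma l1norm_widen n p : (size p <= n)%N -> l1norm p = \sum_(i < n) `|p`_i|.
Proof.
move=> pn; rewrite /l1norm (big_ord_widen _ (fun i => `|p`_i|) pn) big_mkcond/=.
apply: eq_bigr => i _; case: ltnP => // /(nth_default 0) ->.
by rewrite normr0.
Qed.

Lemma l1normD p q : l1norm (p + q) <= l1norm p + l1norm q.
Proof.
rewrite (l1norm_widen (size_polyD p q)).
rewrite (l1norm_widen (leq_maxl (size p) (size q))).
rewrite (l1norm_widen (leq_maxr (size p) (size q))) -big_split/=.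
by apply: ler_sum => i _; rewrite coefD ler_normD.
Qed.

Lemma l1normZ (a : R) p : l1norm (a *: p) = `|a| * l1norm p.
Proof.
rewrite (l1norm_widen (size_scale_leq a p)) /l1norm mulr_sumr.
by apply: eq_bigr => i _; rewrite coefZ normrM.
Qed.

Lemma l1norm_eq0 p : l1norm p = 0 -> p = 0.
Proof.
move=> p0; apply/polyP => i; rewrite coef0.
case: (ltnP i (size p)) => [ip|/(nth_default 0)//].
move/eqP: p0.
rewrite psumr_eq0 => [/allP/(_ (Ordinal ip))|j _]; last exact: normr_ge0.
by rewrite mem_index_enum normr_eq0 => /(_ isT)/eqP.
Qed.

(** The monomial falls on a coordinate where [p] vanishes, so absolute values add exactly. With
    [p = 0] this is the norm of a monomial; in general it produces the kink of the norm. *)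
Lemma l1norm_addMXn (c : R) p n : (size p <= n)%N ->
  l1norm (p + c *: 'X^n) = l1norm p + `|c|.
Proof.
move=> pn; have sX : (size (p + c *: 'X^n)%R <= n.+1)%N.
  rewrite (leq_trans (size_polyD _ _))// geq_max (leq_trans pn)//=.
  by rewrite (leq_trans (size_scale_leq _ _))// size_polyXn.
rewrite (l1norm_widen sX) big_ord_recr/= (l1norm_widen pn); congr (_ + _).
  apply: eq_bigr => i _.
  by rewrite coefD coefZ coefXn (ltn_eqF (ltn_ord i)) mulr0 addr0.
by congr `|_|; rewrite coefD coefZ coefXn eqxx mulr1 nth_default ?add0r.
Qed.

End L1Norm.

HB.instance Definition _ (R : realType) :=
  @Lmodule_isNormed.Build R (l1poly R)
    (@l1norm R) (@l1normD R) (@l1normZ R) (@l1norm_eq0 R).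

Lemma norm_l1polyE (R : realType) (p : l1poly R) : `|p| = l1norm p.
Proof. by []. Qed.

(** * Disjoint bumps, cut off one after another *)

Section Bumps.
Variables (R : realType) (X : topologicalType) (Y : set X).
Hypothesis sepX : forall a b : X, a != b ->
  exists u : X -> R, [/\ continuous u, u a = 0 & u b = 1].

(** Invariant of the recursion: the support of [w] is the room left for later bumps. *)
Let large (w : X -> R) :=
  continuous w /\ infinite_set (Y `&` [set x | w x != 0]).

(** [h] is the bump cut out of [w], and [w'] is the remainder, from which the next bumps are cut. *)
Let splits (w h w' : X -> R) := [/\ continuous h, exists2 y, Y y & h y != 0,
  forall x, h x = 0 \/ w' x = 0 & forall x, w x = 0 -> h x = 0 /\ w' x = 0].

(** Cut [w] at a level of [u] strictly between 0 and 1/2, here 1/3: the part below keeps [a], the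
    part above keeps the infinitely many points with [u >= 1/2]. *)
Lemma splits_of_level (w u : X -> R) (a : X) : large w -> continuous u ->
  Y a -> w a != 0 -> u a = 0 ->
  infinite_set (Y `&` [set x | w x != 0] `&` [set x | 2^-1 <= u x]) ->
  exists h w', large w' /\ splits w h w'.
Proof.
move=> [cw _] cu Ya wa ua inf.
exists (fun x => w x * Num.max (3^-1 - u x) 0).
exists (fun x => w x * Num.max (u x - 3^-1) 0).
have cmax (f : X -> R) : continuous f -> continuous (fun x => Num.max (f x) 0).
  move=> cf x; apply: (@continuous_max _ _ f (cst 0)); first exact: cf.
  exact: cst_continuous.
split; [split|split].
- move=> x; apply: (@continuousM _ _ w (fun x => Num.max (u x - 3^-1) 0)).
    exact: cw.
  by apply: cmax => z; apply: cvgB; [exact: cu|exact: cvg_cst].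
- apply: contra_not inf; apply: sub_finite_set => x [[Yx wx] ux].
  split=> //=; rewrite mulf_neq0//.
  by rewrite gt_eqF// lt_max subr_gt0 (lt_le_trans _ ux)//; lra.
- move=> x; apply: (@continuousM _ _ w (fun x => Num.max (3^-1 - u x) 0)).
    exact: cw.
  by apply: cmax => z; apply: cvgB; [exact: cvg_cst|exact: cu].
- by exists a => //; rewrite ua subr0 mulf_neq0// gt_eqF// lt_max.
- move=> x; case: (leP (u x) 3^-1) => ux.
    by right; rewrite [Num.max _ _]max_r ?mulr0// subr_le0.
  by left; rewrite [Num.max _ _]max_r ?mulr0// subr_le0 ltW.
- by move=> x ->; rewrite !mul0r.
Qed.

Lemma large_splits (w : X -> R) : large w ->
  exists h w', large w' /\ splits w h w'.
Proof.
move=> lw; have [cw iw] := lw.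
have [a [Ya wa]] := infinite_setN0 iw.
have [b [[Yb wb] /eqP ba]] : (Y `&` [set x | w x != 0]) `\ a !=set0.
  apply: infinite_setN0; apply: contra_not iw => fD.
  by rewrite -(@setD1K _ a (Y `&` _))// finite_setU; split=> //; exact: finite_set1.
have [u [cu ua ub]] : exists u : X -> R, [/\ continuous u, u a = 0 & u b = 1].
  by apply: sepX; rewrite eq_sym.
(* One of [u >= 1/2] and [1 - u >= 1/2] keeps infinitely many points of [Y]. *)
have [inf|fin] := pselect
    (infinite_set (Y `&` [set x | w x != 0] `&` [set x | 2^-1 <= u x])).
  exact: (splits_of_level lw cu Ya wa ua inf).
(* Passing to [1 - u] exchanges the roles of [a] and [b]. *)
apply: (@splits_of_level w (fun x => 1 - u x) b) => //.
- by move=> x; apply: cvgB; [exact: cvg_cst|exact: cu].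
- by rewrite ub subrr.
- apply: contra_not iw => fin'.
  apply: (@sub_finite_set _ _ ((Y `&` [set x | w x != 0] `&` [set x | 2^-1 <= u x])
    `|` (Y `&` [set x | w x != 0] `&` [set x | 2^-1 <= 1 - u x]))).
    move=> x Sx /=; case: (leP 2^-1 (u x)) => ux; [by left|right; split=> //=].
    by lra.
  by rewrite finite_setU; split=> //; exact: contrapT.
Qed.

Lemma disjoint_bumps : infinite_set Y -> exists g : nat -> X -> R,
  [/\ forall n, continuous (g n), forall n, exists2 y, Y y & g n y != 0 &
      forall m n x, (m < n)%N -> g m x = 0 \/ g n x = 0].
Proof.
move=> infY.
pose S := {hw : (X -> R) * (X -> R) | large hw.2}.
have step (s : S) : {s' : S | splits (sval s).2 (sval s').1 (sval s').2}.
  apply: cid; case: s => -[h0 w] lw /=.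
  have [h [w' [lw' sp]]] := large_splits lw.
  by exists (exist _ (h, w') lw').
have large1 : large (cst 1).
  split; first exact: cst_continuous.
  apply: contra_not infY; apply: sub_finite_set => y Yy; split=> //=.
have [s [_ sP]] := dependent_choice step (exist _ (cst 0, cst 1) large1).
(* The shift skips the placeholder [cst 0] of the initial pair. *)
exists (fun n => (sval (s n.+1)).1); split=> [n|n|m n x].
- by have [] := sP n.
- by have [] := sP n.
- move=> mn; have [_ _ /(_ x)[->|w0] _] := sP m; [by left|right].
  (* The remainder left after bump [m] vanishes at [x]; zeros pass on to all later remainders, hence
     to bump [n]. *)
  suff: (sval (s n)).2 x = 0 by move=> wn; have [_ _ _ /(_ _ wn)[]] := sP n.
  rewrite -(subnKC mn); elim: (n - m.+1)%N => [|k IHk]; first by rewrite addn0.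
  by rewrite addnS; have [_ _ _ /(_ _ IHk)[]] := sP (m.+1 + k)%N.
Qed.

End Bumps.

(** * The continuous map into the l1 space *)

Lemma l1_bump_map (R : realType) (X : topologicalType) (g : nat -> X -> R) :
  (forall n, continuous (g n)) ->
  (forall m n x, (m < n)%N -> g m x = 0 \/ g n x = 0) ->
  exists F : X -> l1poly R, continuous F /\
    forall n x, g n x != 0 ->
      exists2 c : R, c != 0 & F x = c *: 'X^n.
Proof.
move=> cg0 dg0.
(* The cap keeps the zero set of each bump and makes the tail of the sequence uniformly small. *)
pose h n x := Num.min `|g n x| n.+1%:R^-1.
have h0 n x : (h n x == 0) = (g n x == 0).
  rewrite /h -[RHS]normr_eq0; have := normr_ge0 (g n x).
  case: (leP `|g n x| n.+1%:R^-1) => // gn _.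
  rewrite invr_eq0 pnatr_eq0/=; apply/esym/negbTE.
  by rewrite normr_eq0 -normr_gt0 (lt_trans _ gn)// invr_gt0.
have h_ge0 n x : 0 <= h n x by rewrite le_min normr_ge0 invr_ge0 ler0n.
have h_le n x : h n x <= n.+1%:R^-1 by rewrite ge_min lexx orbT.
have ch n : continuous (h n).
  move=> x; apply: (@continuous_min _ _ (fun x => `|g n x|) (cst n.+1%:R^-1)).
    by apply: cvg_norm; exact: cg0.
  exact: cst_continuous.
(* [N x] is the index of the only bump that may be nonzero at [x], and is arbitrary if there is
   none. *)
have /choice[N NP] x : exists n, forall m, m != n -> h m x = 0.
  have [[n gn]|/forallNP ng] := pselect (exists n, g n x != 0); last first.
    by exists 0%N => m _; apply/eqP; rewrite h0; apply: contrapT => /negP/ng.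
  exists n => m; rewrite neq_lt => /orP[mn|mn]; apply/eqP; rewrite h0;
    by case: (dg0 _ _ x mn) gn => ->; rewrite eqxx.
have NE n x : h n x != 0 -> N x = n.
  by move=> hn; apply/eqP/negP => /negP; rewrite eq_sym => /NP/eqP; apply/negP.
exists (fun x => h (N x) x *: 'X^(N x)); split; last first.
  move=> n x gn; have hn : h n x != 0 by rewrite h0.
  by exists (h n x); rewrite ?(NE _ _ hn).
move=> x0; apply/cvgrPdist_lt => e e0.
(* If all bumps vanish at [x0], the index [N x] may jump near [x0]: bumps up to [K] are small there
   by continuity, the others by the cap. *)
have [hx0|hx0] := eqVneq (h (N x0) x0) 0.
  have hx n : h n x0 = 0 by have [->|/NP] := eqVneq n (N x0).
  pose K := Num.truncn e^-1.
  have Ke : K.+1%:R^-1 < e.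
    by rewrite invf_plt ?posrE// truncnS_gt.
  have : \forall x \near x0, forall k : 'I_K.+1, h k x < e.
    apply: filter_forall => k; apply: (cvgr_lt (h k x0)); first exact: ch.
    by rewrite hx.
  apply: filterS => x hxe; rewrite hx0 scale0r sub0r normrN norm_l1polyE.
  rewrite -[X in l1norm X]add0r l1norm_addMXn ?size_poly0// ger0_norm//.
  rewrite [l1norm 0]big1 ?add0r; last by move=> i _; rewrite coef0 normr0.
  have [NK|KN] := ltnP (N x) K.+1; first exact: (hxe (Ordinal NK)).
  apply: le_lt_trans (h_le _ _) (le_lt_trans _ Ke).
  by rewrite lef_pV2 ?posrE// ler_nat ltnW.
(* Otherwise the bump of index [N x0] stays nonzero near [x0], so the index is locally constant. *)
have near_ne : \forall x \near x0, h (N x0) x != 0.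
  by apply: (cvgr_neq0 (h (N x0) x0)) => //; exact: ch.
have near_e : \forall x \near x0, `|h (N x0) x0 - h (N x0) x| < e.
  by move: e e0; apply/cvgrPdist_lt; exact: ch.
near=> x.
rewrite (NE (N x0) x); last by near: x.
rewrite -scalerBl norm_l1polyE -[X in l1norm X]add0r l1norm_addMXn ?size_poly0//.
rewrite [l1norm 0]big1 ?add0r; last by move=> i _; rewrite coef0 normr0.
by near: x.
Unshelve. all: by end_near. Qed.

(** * Failure of differentiability, and the theorem *)

Lemma l1_functional_not_GDS (R : realType) (E : tvsType R)
    (T : {linear E -> l1poly R}) : continuous T ->
  (forall N, exists n w (c : R), [/\ (N <= n)%N, c != 0 & T w = c *: 'X^n]) ->
  ~ GDS E.
Proof.
move=> cT bigT gds.
pose f : E -> R^o := fun v => `|T v|.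
have cf : continuous f by move=> v; apply: cvg_norm; exact: cT.
have ndiff x : ~ gateaux_differentiable f x.
  move=> [df [_ dfP]].
  (* A monomial beyond the size of [T x] gives a direction with one-sided derivatives [|c|] and
     [-|c|]. *)
  have [n [w [c [xn c0 Tw]]]] := bigT (size (T x : {poly R})).
  have fE t : f (x + t *: w) - f x = `|t * c|.
    rewrite /f linearD linearZ/= Tw scalerA !norm_l1polyE l1norm_addMXn//.
    by rewrite addrAC subrr add0r.
  have rlim : (f (x + t *: w) - f x) / t @[t --> 0^'+] --> `|c|.
    apply: cvg_near_cst; near=> t; have t0 : 0 < t by [].
    by rewrite fE normrM gtr0_norm// mulrAC mulfV ?mul1r// gt_eqF.
  have llim : (f (x + t *: w) - f x) / t @[t --> 0^'-] --> - `|c|.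
    apply: cvg_near_cst; near=> t; have t0 : t < 0 by [].
    by rewrite fE normrM ltr0_norm// mulrAC mulNr mulfV ?mulN1r// lt_eqF.
  have cc : `|c| = - `|c|.
    transitivity (df w).
      exact: cvg_unique rlim (cvg_dnbhs_at_right (dfP w)).
    exact: cvg_unique (cvg_dnbhs_at_left (dfP w)) llim.
  by move: c0; rewrite -normr_gt0; lra.
have : closure [set x | setT x /\ gateaux_differentiable f x] 0.
  apply: (gds setT f) => //.
  - by exists 0.
  - exact: openT.
  - by apply: continuous_subspaceT => v; exact: cf.
  - move=> t x y _ _; rewrite /f.
    rewrite /conv/= linearD !linearZ/=.
    rewrite (le_trans (ler_normD _ _))// !normrZ.
    by rewrite !ger0_norm ?onem_ge0 ?subr_ge0//.
suff -> : [set x | setT x /\ gateaux_differentiable f x] = set0.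
  by rewrite closure0.
by apply/seteqP; split=> x// -[_ /ndiff].
Unshelve. all: by end_near. Qed.

Theorem theorem4p2 (R : realType) (X : topologicalType) (L : tvsType R)
    (i : X -> L) (hX : tychonoff_space X) (hL : free_lcs i) :
  (forall Y : set X, infinite_set Y -> ~ GDS (span_of (i @` Y))) /\
  (infinite_set [set: X] -> ~ GDS L).
Proof.
have sepX (a b : X) : a != b ->
    exists u : X -> R, [/\ continuous u, u a = 0 & u b = 1].
  move=> ab; have [cr hd] := hX.
  have cb : closed [set b].
    exact/accessible_closed_set1/hausdorff_accessible.
  have /(uniform_separatorP (R := R))[u [cu _ ua ub]] :=
    cr a [set b] cb (elimN eqP ab).
  by exists u; split; [|apply: ua; exists a|apply: ub; exists b].
have lift (Y : set X) : infinite_set Y -> exists T : {linear L -> l1poly R},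
    continuous T /\ forall N, exists n y (c : R),
      [/\ Y y, (N <= n)%N, c != 0 & T (i y) = c *: 'X^n].
  move=> infY; have [g [cg gY dg]] := disjoint_bumps sepX infY.
  have [F [cF FE]] := l1_bump_map cg dg.
  have [_ _ /(_ (l1poly R) F (@norm_hausdorff _ _) cF)] := hL.
  move=> [T [[linT cT TE] _]].
  pose T' : {linear L -> l1poly R} :=
    HB.pack T (GRing.isLinear.Build _ _ _ _ T linT).
  exists T'; split=> // N; have [y Yy /FE[c c0 Fy]] := gY N.
  by exists N, y, c; split=> //; rewrite -Fy TE.
split=> [Y /lift[T [cT TY]]|/lift[T [cT TY]]]; last first.
  apply: (l1_functional_not_GDS cT) => N.
  by have [n [y [c [_ Nn c0 Ty]]]] := TY N; exists n, (i y), c.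
have linTv : linear (T \o (val : span_of (i @` Y) -> L)).
  by move=> a u v /=; exact: linearP.
pose T' : {linear span_of (i @` Y) -> l1poly R} :=
  HB.pack (T \o val) (GRing.isLinear.Build _ _ _ _ _ linTv).
apply: (@l1_functional_not_GDS _ _ T') => [|N].
  move=> v; apply: continuous_comp; first exact: initial_continuous.
  exact: cT.
have [n [y [c [Yy Nn c0 Ty]]]] := TY N.
have iy : i y \in lspan (i @` Y).
  apply/mem_set; exists 1%N, (fun=> 1), (fun=> i y); split; first by exists y.
  by rewrite big_ord1 scale1r.
by exists n, (Sub (i y) iy : span_of (i @` Y)), c; split=> //; rewrite -Ty.
Qed.
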